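(* For each non-negative integer $n$, \[ \sum_{k=0}^n (-1)^{k} \binom {n+k}{k} F_{2(n+1)+k} = 1 - \sum_{k=0}^{n-1} (-1)^{k} \binom {2k+1}{k} F_{3(k+2)}, \] \[ \sum_{k=0}^n (-1)^{k} \binom {n+k}{k} L_{2(n+1)+k} = 3 - \sum_{k=0}^{n-1} (-1)^{k} \binom {2k+1}{k} L_{3(k+2)}. \]
   Context: $F_j$ and $L_j$ denote the Fibonacci and Lucas numbers: $F_0=0,F_1=1$, $L_0=2,L_1=1$, both satisfying $X_j=X_{j-1}+X_{j-2}$. *)

(* Defs.v *)
From mathcomp Require Import all_boot all_order all_algebra.

Set Implicit Arguments.
Unset Strict Implicit.
Unset Printing Implicit Defensive.

Local Open Scope nat_scope.

Fixpoint fib (n : nat) : nat :=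
  match n with
  | 0 => 0
  | 1 => 1
  | (m.+1 as p).+1 => fib p + fib m
  end.

Fixpoint lucas (n : nat) : nat :=
  match n with
  | 0 => 2
  | 1 => 1
  | (m.+1 as p).+1 => lucas p + lucas m
  end.

(* Main.v *)
Require Import Defs.
From mathcomp Require Import all_boot all_order all_algebra.
From mathcomp Require Import zify ring.

(** Let [x ^ 2 = x + 1] and [P_n y = \sum_(k <= n) 'C(n + k, k) y ^ k].  Pascal's
    rule gives [(1 - y) P_(n+1) y = P_n y + 'C(2n+1, n) y ^ (n+1) (1 - 2 y)].
    At [y = - x] we have [1 - y = x ^ 2] and [1 - 2 y = x ^ 3], so that
    [x ^ (2(n+2)) P_(n+1) (-x) - x ^ (2(n+1)) P_n (-x)] is the single term
    [- (-1) ^ n 'C(2n+1, n) x ^ (3(n+2))] and the sum telescopes.  Replacing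
    powers of [x] by terms of a sequence with [G (m+2) = G (m+1) + G m] gives
    the Fibonacci and Lucas cases at once. *)

Set Implicit Arguments.
Unset Strict Implicit.
Unset Printing Implicit Defensive.

Import GRing.Theory.
Local Open Scope ring_scope.

(** Plays the role of [x ^ j P_n (- x)]; [j] is kept apart from [n] so that multiplying by [x] is a
    shift of [j]. *)
Definition alt_bin_sum (G : nat -> int) (n j : nat) : int :=
  \sum_(0 <= k < n.+1) (-1) ^+ k * 'C(n + k, k)%:Z * G (j + k)%N.

Lemma bin_double_succ (n : nat) :
  'C(n.+1 + n.+1, n.+1) = (2 * 'C(2 * n + 1, n))%N.
Proof.
have -> : (n.+1 + n.+1 = (2 * n + 1).+1)%N by lia.
rewrite binS -(@bin_sub _ n.+1); last by lia.
have -> : (2 * n + 1 - n.+1 = n)%N by lia.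
lia.
Qed.

Lemma bin_middle (n : nat) : 'C(n + n.+1, n.+1) = 'C(2 * n + 1, n).
Proof.
rewrite -bin_sub; last by lia.
by congr 'C(_, _); lia.
Qed.

Lemma alt_bin_sum_pascal (G : nat -> int) (n j : nat) :
  alt_bin_sum G n.+1 j + alt_bin_sum G n.+1 j.+1 =
  alt_bin_sum G n j
    - (-1) ^+ n * 'C(2 * n + 1, n)%:Z * (G (j + n.+1)%N + 2 * G (j + n.+2)%N).
Proof.
pose A := \sum_(0 <= k < n.+1) (-1) ^+ k * 'C(n + k.+1, k.+1)%:Z * G (j + k.+1)%N.
pose B := \sum_(0 <= k < n.+1) (-1) ^+ k * 'C(n.+1 + k, k)%:Z * G (j.+1 + k)%N.
pose c : int := 'C(2 * n + 1, n)%:Z.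
(* Pascal's rule splits each term past the first between [A] and [B]. *)
have pascal : alt_bin_sum G n.+1 j = G j - A - B.
  rewrite /alt_bin_sum big_nat_recl // expr0 bin0 !mul1r addn0.
  rewrite -addrA -opprD /A /B -big_split -sumrN /=; congr (_ + _).
  apply: eq_bigr => k _.
  rewrite exprS !addnS !addSn binS PoszD -?addnS.
  ring.
(* [G j - A] is the sum for [n] with one extra term, [k = n + 1]. *)
have A_eq : G j - A = alt_bin_sum G n j - (-1) ^+ n * c * G (j + n.+1)%N.
  have : alt_bin_sum G n j + (-1) ^+ n.+1 * 'C(n + n.+1, n.+1)%:Z * G (j + n.+1)%N
         = G j - A.
    rewrite /alt_bin_sum -big_nat_recr //= big_nat_recl //.
    rewrite expr0 bin0 !mul1r addn0 /A -sumrN; congr (_ + _).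
    by apply: eq_bigr => k _; rewrite exprS; ring.
  by rewrite bin_middle exprS => <-; rewrite /c; ring.
(* [B] lacks only the top term, whose central binomial is [2 * c]. *)
have B_eq : alt_bin_sum G n.+1 j.+1 = B - (-1) ^+ n * (2 * c) * G (j + n.+2)%N.
  rewrite /alt_bin_sum big_nat_recr //= bin_double_succ PoszM exprS.
  by rewrite addSnnS -/B /c; ring.
by rewrite pascal A_eq B_eq -/c; ring.
Qed.

Lemma alt_bin_sum_telescope (G : nat -> int) (n : nat) :
    (forall m, G m.+2 = G m.+1 + G m) ->
  alt_bin_sum G n (2 * (n + 1)) =
  G 2 - \sum_(0 <= k < n) (-1) ^+ k * 'C(2 * k + 1, k)%:Z * G (3 * (k + 2))%N.
Proof.
move=> GE; elim: n => [|n IHn].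
  by rewrite /alt_bin_sum big_nat1 big_geq // subr0 expr0 bin0 !mul1r.
have shift j : alt_bin_sum G n.+1 j.+2 =
    alt_bin_sum G n.+1 j + alt_bin_sum G n.+1 j.+1.
  rewrite /alt_bin_sum -big_split /=; apply: eq_bigr => k _.
  by rewrite !addSn GE; ring.
have -> : (2 * (n.+1 + 1) = (2 * (n + 1)).+2)%N by lia.
rewrite shift alt_bin_sum_pascal IHn big_nat_recr //=.
have -> : (2 * (n + 1) + n.+1 = 3 * n + 3)%N by lia.
have -> : (2 * (n + 1) + n.+2 = (3 * n + 3).+1)%N by lia.
have -> : (3 * (n + 2) = (3 * n + 3).+3)%N by lia.
(* With [m = 3 * n + 3], this is [G m + 2 * G (m + 1) = G (m + 3)], the form of
   [1 + 2 x = x ^ 3]. *)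
by rewrite !GE; ring.
Qed.

Theorem theorem17 (n : nat) :
  \sum_(0 <= k < n.+1)
     (-1) ^+ k * 'C(n + k, k)%:Z * (fib (2 * (n + 1) + k)%N)%:Z
  = 1 - \sum_(0 <= k < n)
     (-1) ^+ k * 'C(2 * k + 1, k)%:Z * (fib (3 * (k + 2))%N)%:Z
  /\
  \sum_(0 <= k < n.+1)
     (-1) ^+ k * 'C(n + k, k)%:Z * (lucas (2 * (n + 1) + k)%N)%:Z
  = 3 - \sum_(0 <= k < n)
     (-1) ^+ k * 'C(2 * k + 1, k)%:Z * (lucas (3 * (k + 2))%N)%:Z.
Proof.
(* The constants 1 and 3 are the values of [G 2]. *)
split.
- exact: (@alt_bin_sum_telescope (fun m => (fib m)%:Z)).
- exact: (@alt_bin_sum_telescope (fun m => (lucas m)%:Z)).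
Qed.
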